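(* Let $m \geq 1$, let $k = 2m+4$, and let $G$ be a connected $SC_k$ graph. Suppose $G$ has two induced cycles $S_i, S_j$ with $|E(S_i)\cap E(S_j)| = \frac{k}{2}$, i.e. $G$ contains $CAGE(3, \frac{k}{2}+1)$. Let $s$ be the size of the maximum cage, i.e. the largest $n$ such that $G$ contains $CAGE(n, \frac{k}{2}+1)$. Then every minimal vertex separator of $G$ has cardinality at most $s$.
   Context: All graphs are finite, simple and undirected. A graph $G$ is an $SC_k$ graph if either $G$ has no cycle, or every induced cycle of $G$ has length exactly $k$. For non-adjacent vertices $u,v$, a set $R \subset V(G)$ is a $(u,v)$-vertex separator if $u$ and $v$ lie in different connected components of $G - R$; it is minimal if no proper subset of $R$ is a $(u,v)$-vertex separator. A minimal vertex separator of $G$ is a set that is a minimal $(u,v)$-vertex separator for some pair of non-adjacent vertices $u,v$. For $n, l$, a cage graph $CAGE(n,l)$ consists of two vertices $w,z$ together with $n$ paths $P^i = (u^i_1, \ldots, u^i_{l-2})$, $1 \le i \le n$, on $l-2$ vertices each, such that $w$ is adjacent to $u^i_1$ and $z$ is adjacent to $u^i_{l-2}$ for all $i$; thus it is the union of $n$ internally disjoint $w$–$z$ paths, each with $l$ vertices. $G$ contains $CAGE(n,l)$ if it has such a configuration. *)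

(* Defs.v *)
(* A finite simple undirected graph is a symmetric irreflexive relation
   [e : rel T] on a finType of vertices. *)
From mathcomp Require Import all_boot.

Set Implicit Arguments.
Unset Strict Implicit.
Unset Printing Implicit Defensive.

Section Graph.
Variables (T : finType) (e : rel T).

Definition connected_graph : Prop := forall x y : T, connect e x y.

(* A cycle is listed by its vertices in cyclic order, up to rotation and
   reversal; its length is [size c]. *)
Definition graph_cycle (c : seq T) : bool :=
  [&& 2 < size c, cycle e c & uniq c].

Definition cycle_edges (c : seq T) : {set {set T}} :=
  [set [set x; next c x] | x in c].

Definition induced_cycle (c : seq T) : Prop :=
  graph_cycle c /\
  {in c &, forall x y, e x y -> [set x; y] \in cycle_edges c}.

Definition SC (k : nat) : Prop :=
  (~ exists c, graph_cycle c) \/ (forall c, induced_cycle c -> size c = k).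

(* The edges of G - R. It is a relation on all of T, under which the vertices
   of R are isolated, hence the first two conditions in [separator]. *)
Definition del_edges (R : {set T}) : rel T :=
  [rel x y | [&& x \notin R, y \notin R & e x y]].

Definition separator (u v : T) (R : {set T}) : bool :=
  [&& u \notin R, v \notin R & ~~ connect (del_edges R) u v].

Definition minimal_vertex_separator (R : {set T}) : Prop :=
  exists u v : T, [/\ u != v, ~~ e u v & minset (separator u v) R].

(* CAGE(n, l), for l >= 3, as a not necessarily induced subgraph: the list Ps
   holds the n internal paths (u_1, ..., u_(l-2)). *)
Definition contains_cage (n l : nat) : Prop :=
  exists (w z : T) (Ps : seq (seq T)),
    [/\ size Ps = n,
        {in Ps, forall p, size p = l - 2 /\ path e w (rcons p z)}
      & uniq (w :: z :: flatten Ps)].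

Definition max_cage_size (l s : nat) : Prop :=
  contains_cage s l /\ forall n, contains_cage n l -> n <= s.

End Graph.

(* Main.v *)
(* Write k = 2h; every cycle has length at least k, since a shortest one is
   induced.  Let C be an induced cycle.  An induced path outside C from a
   neighbour of c to a neighbour of c', with no other attachment on C, forms an
   induced cycle with each of the two arcs of C between c and c', unless c and
   c' are adjacent; so c and c' are adjacent, or both arcs and the path have
   h - 1 inner vertices.  Consequently a connected set disjoint from C attaches
   to at most two vertices of C, and any two such paths with nonadjacent ends
   have the same ends.

   Let R be a minimal (u,v)-separator with at least three vertices, and A, B the
   components of u, v in G - R: every vertex of R has neighbours in both.  As G
   has no triangle, R has nonadjacent r1, r2; induced r1-r2 paths through A and
   through B form an induced cycle C.  Any other r in R lies on a path outside C
   from some w in A to some z in B, and w, z do not depend on r.  This gives #|R|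
   distinct w-z paths of length h, which are internally disjoint because all
   cycles have length at least 2h. *)
Require Import Defs.
From mathcomp Require Import all_boot.
From mathcomp Require Import zify.

Set Implicit Arguments.
Unset Strict Implicit.
Unset Printing Implicit Defensive.

(** * Induced paths and induced cycles as lists *)

Lemma head_rev (T : Type) (x : T) s : head x (rev s) = last x s.
Proof. by case: (lastP s) => // s' y; rewrite rev_rcons last_rcons. Qed.

Lemma last_rev (T : Type) (x : T) s : last x (rev s) = head x s.
Proof. by rewrite -head_rev revK. Qed.

Section InducedPaths.
Variables (T : finType) (e : rel T).
Hypotheses (e_sym : symmetric e) (e_irr : irreflexive e).

(** The default [x] of [head] is never reached: for empty [s'] the [all] is vacuous. *)
Fixpoint induced_path (s : seq T) : bool :=
  if s is x :: s' then
    [&& x \notin s', all (fun v => e x v == (v == head x s')) s'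
      & induced_path s']
  else true.

(* [x :: rcons s y] is an induced path, except that [x] and [y] may be adjacent
   or equal: an ear of a cycle may have adjacent ends. *)
Definition link (x : T) (s : seq T) (y : T) : Prop :=
  [/\ s != [::], induced_path s, x \notin s /\ y \notin s
    & {in s, forall v, e x v = (v == head x s) /\ e y v = (v == last x s)}].

(** An induced cycle, triangles included, presented as a base vertex and the induced path formed by
    the others. Cutting and gluing at two vertices then become list concatenation. *)
Definition hole (c : seq T) : Prop :=
  if c is x :: s then
    [/\ 1 < size s, induced_path s, x \notin s
      & {in s, forall v, e x v = (v == head x s) || (v == last x s)}]
  else False.

(** The tool for cutting and gluing: the only edge between the two pieces is the one at the cut. The
    defaults of [last] and [head] are not reached, since [x] and [y] witness that both lists are
    nonempty. *)
Lemma induced_path_cat s t :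
  induced_path (s ++ t) <->
  [/\ induced_path s, induced_path t
    & forall x y, x \in s -> y \in t ->
        x != y /\ e x y = (x == last y s) && (y == head x t)].
Proof.
elim: s => [|x s IH] /=; first by split=> [|[]].
split.
- case/and3P => xN /allP xA /IH [ips ipt st]; split=> //.
  + apply/and3P; split=> //; first by apply: contra xN; rewrite mem_cat => ->.
    apply/allP=> v vs; rewrite (eqP (xA v _)) ?mem_cat ?vs //.
    by case: (s) vs.
  + move=> a b; rewrite inE => /orP[/eqP->|aS] bt.
      split; first by apply: contraNneq xN => ->; rewrite mem_cat bt orbT.
      rewrite (eqP (xA b _)) ?mem_cat ?bt ?orbT //.
      case: (s) xN st => [|c s'] //= xN st; first by rewrite eqxx.
      have [cb _] := st c b (mem_head _ _) bt.
      rewrite eq_sym (negbTE cb) [x == _](_ : _ = false) //.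
      apply: contraNF xN => /eqP->.
      by rewrite -cat_cons mem_cat mem_last.
    have [-> ->] := st a b aS bt; split=> //.
    by case: (s) aS.
- case=> /and3P[xN /allP xA ips] ipt st.
  have disj v : v \in t -> v \notin s.
    move=> vt; apply/negP=> vs.
    by have [] := st v v; rewrite ?inE ?vs ?orbT ?eqxx.
  apply/and3P; split.
  - rewrite mem_cat negb_or xN /=; apply/negP=> xt.
    by have [] := st x x (mem_head _ _) xt; rewrite eqxx.
  - apply/allP=> v; rewrite mem_cat => /orP[vs|vt].
      by rewrite (eqP (xA v vs)); case: (s) vs.
    have [_ ->] := st x v (mem_head _ _) vt.
    case: (s) xN disj => [|c s'] /= xN disj; first by rewrite eqxx.
    rewrite [x == _](_ : _ = false) /=; last first.
      by apply: contraNF xN => /eqP->; apply: mem_last.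
    rewrite eq_sym [v == c](_ : _ = false) //.
    by apply: contraNF (disj v vt) => /eqP->; apply: mem_head.
  - apply/IH; split=> // a b aS bt.
    have aS' : a \in x :: s by rewrite inE aS orbT.
    have [-> ->] := st a b aS' bt; split=> //.
    by case: (s) aS.
Qed.

Lemma induced_path_rev s : induced_path s -> induced_path (rev s).
Proof.
elim: s => //= x s IH /and3P[xN /allP xA /IH ipr].
rewrite rev_cons -cats1; apply/induced_path_cat; split=> // a b.
rewrite mem_rev inE => aS /eqP->; split.
  by apply: contraNneq xN => <-.
rewrite e_sym (eqP (xA a aS)) eqxx andbT.
by case: (s) aS => //= c s' _; rewrite rev_cons last_rcons.
Qed.

Lemma induced_path_uniq s : induced_path s -> uniq s.
Proof. by elim: s => //= x s IH /and3P[-> _ /IH]. Qed.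

Lemma induced_path_path x s : induced_path (x :: s) -> path e x s.
Proof.
elim: s x => //= y s IH x /and3P[_ /andP[/eqP exy _]].
by move=> ip; rewrite exy eqxx; apply: IH.
Qed.

Lemma link_rev x s y : link x s y -> link y (rev s) x.
Proof.
case: s => [|a s]; case=> // _ ip [xN yN] adj.
have rE : exists b t, rev (a :: s) = b :: t.
  by case: (rev _) (size_rev (a :: s)) => // b t _; exists b, t.
have lastE z : last z (rev (a :: s)) = a by rewrite rev_cons last_rcons.
have headE z : head z (rev (a :: s)) = last a s.
  by rewrite lastI rev_rcons.
split.
- by case: rE => b [t ->].
- exact: induced_path_rev.
- by rewrite !mem_rev.
- move=> v; rewrite mem_rev => /adj[ex ey].
  by rewrite lastE headE ex ey.
Qed.

Lemma link_path x s y : link x s y -> path e x (rcons s y).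
Proof.
case: s => [|a s]; case=> // _ ip _ adj.
rewrite rcons_path /=.
rewrite (induced_path_path ip) /=.
have [-> _] := adj a (mem_head _ _).
rewrite e_sym; have [_ ->] := adj (last a s) (mem_last _ _).
by rewrite !eqxx.
Qed.

(** The source of new induced cycles, to which the length condition of [SC] is then applied. *)
Lemma hole_of_links x p y q :
  link x p y -> link y q x -> x != y -> ~~ e x y ->
  {in p & q, forall a b, a != b /\ ~~ e a b} ->
  hole (x :: p ++ y :: q).
Proof.
move=> [p0 ipp [xp yp] adjp] [q0 ipq [yq xq] adjq] xy exy pq.
split.
- by case: (p) p0 (q) q0 => // a p' _ [] // b q' _; rewrite size_cat /=; lia.
- apply/induced_path_cat; split=> //=.
  + rewrite yq ipq andbT; apply/allP=> v vq.
    by have [-> _] := adjq v vq.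
  + move=> a b ap; rewrite inE => /orP[/eqP->|bq].
      split; first by apply: contraNneq yp => <-.
      rewrite e_sym; have [_ ->] := adjp a ap; rewrite eqxx andbT.
      by case: (p) ap.
    have [ab /negbTE->] := pq a b ap bq; split=> //.
    rewrite [b == y](_ : _ = false) ?andbF //.
    by apply: contraNF yq => /eqP<-.
- by rewrite mem_cat inE !negb_or xp xy.
- move=> v; rewrite mem_cat inE => vin.
  rewrite last_cat /=.
  have -> : head x (p ++ y :: q) = head x p by case: (p) p0.
  case/or3P: vin => [vp|/eqP->|vq].
  + have [-> _] := adjp v vp.
    rewrite [v == last y q](_ : _ = false) ?orbF //.
    have lq : last y q \in q by case: (q) q0 => //= b q' _; apply: mem_last.
    by have [/negbTE->] := pq _ _ vp lq.
  + rewrite (negbTE exy); apply/esym/norP; split.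
      apply: contraNneq yp => ->.
      by case: (p) p0 => //= a p' _; apply: mem_head.
    apply: contraNneq yq => ->.
    by case: (q) q0 => //= b q' _; apply: mem_last.
  + have [_ ->] := adjq v vq.
    rewrite [v == head x p](_ : _ = false) //.
    have hp : head x p \in p by case: (p) p0 => //= a p' _; apply: mem_head.
    by rewrite eq_sym; have [/negbTE->] := pq _ _ hp vq.
Qed.

Lemma hole_rev x s : hole (x :: s) -> hole (x :: rev s).
Proof.
case=> ss ip xN adj; split; rewrite ?size_rev ?mem_rev //.
  exact: induced_path_rev.
move=> v; rewrite mem_rev => vs; rewrite (adj v vs) orbC.
by rewrite last_rev head_rev.
Qed.

(** [hole] singles out a base vertex; moving it to the end shows that the choice does not matter. *)
Lemma hole_rot1 x s : hole (x :: s) -> hole (rcons s x).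
Proof.
case: s => [|y s]; case=> //= ss /and3P[yN /allP adjy ip].
rewrite inE negb_or => /andP[xy xN] adj.
have s0 : s != [::] by case: (s) ss.
split.
- by rewrite size_rcons; lia.
- rewrite -cats1; apply/induced_path_cat; split=> // a b aS; rewrite inE => /eqP->.
  split; first by apply: contraNneq xN => <-.
  rewrite eqxx andbT e_sym adj ?inE ?aS ?orbT //=.
  rewrite [a == y](_ : _ = false) //=; last by apply: contraNF yN => /eqP<-.
  by case: (s) aS.
- by rewrite mem_rcons inE negb_or eq_sym xy.
- move=> v; rewrite mem_rcons inE last_rcons => /orP[/eqP->|vs].
    by rewrite e_sym (adj y (mem_head _ _)) !eqxx orbT.
  rewrite (eqP (adjy v vs)) [v == x](_ : _ = false) ?orbF.
    by case: (s) vs.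
  by apply: contraNF xN => /eqP<-.
Qed.

Lemma hole_catC s t : hole (s ++ t) -> hole (t ++ s).
Proof.
elim: s t => [|x s IH] t; first by rewrite cats0.
by move/hole_rot1; rewrite rcons_cat => /IH; rewrite cat_rcons.
Qed.

Lemma hole_swap x p y q : hole (x :: p ++ y :: q) -> hole (y :: q ++ x :: p).
Proof. exact: (@hole_catC (x :: p) (y :: q)). Qed.

Lemma hole_rot n c : hole (rot n c) <-> hole c.
Proof.
split; first by move/hole_catC; rewrite cat_take_drop.
by move=> hc; apply: hole_catC; rewrite cat_take_drop.
Qed.

Lemma hole_link x p y q : p != [::] -> hole (x :: p ++ y :: q) -> link x p y.
Proof.
move=> p0 [_ /induced_path_cat[ipp _ py] xN adj].
have yp : y \notin p.
  by apply/negP=> yp; have [] := py y y yp (mem_head _ _); rewrite eqxx.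
split=> //.
  by split=> //; apply: contra xN; rewrite mem_cat => ->.
move=> v vp; split.
  rewrite adj ?mem_cat ?vp // [v == last _ _](_ : _ = false).
    by case: (p) p0 => // a p' _; rewrite orbF.
  rewrite last_cat /=; apply/negP=> /eqP E.
  have vyq : v \in y :: q by rewrite E; apply: mem_last.
  by have [] := py v v vp vyq; rewrite eqxx.
have [_] := py v y vp (mem_head _ _).
by rewrite e_sym /= eqxx andbT => ->; case: (p) vp.
Qed.

Lemma hole_adj x p y q :
  hole (x :: p ++ y :: q) -> e x y = (p == [::]) || (q == [::]).
Proof.
move=> [_ /induced_path_cat[_ /= /and3P[yq _ _] py] xN adj].
rewrite adj ?mem_cat ?mem_head ?orbT // last_cat /=.
have yp : y \notin p.
  by apply/negP=> yp; have [] := py y y yp (mem_head _ _); rewrite eqxx.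
congr (_ || _).
  case: (p) yp => [|a p'] /=; first by rewrite !eqxx.
  by rewrite inE negb_or => /andP[/negbTE->].
case: (q) yq => [|a q'] /= yq; first by rewrite !eqxx.
by apply: contraNF yq => /eqP->; apply: mem_last.
Qed.

Lemma hole_graph_cycle c : hole c -> graph_cycle e c.
Proof.
case: c => // x s [ss ip xN adj]; rewrite /graph_cycle /= xN.
rewrite (induced_path_uniq ip) !andbT ltnS ss /= rcons_path.
case: s ss ip xN adj => // y s ss ip xN adj.
rewrite /= (induced_path_path ip) (e_sym (last _ _)).
by rewrite (adj _ (mem_last _ _)) (adj _ (mem_head _ _)) /= !eqxx orbT.
Qed.

Lemma cycle_edges_rot n (c : seq T) : uniq c -> cycle_edges (rot n c) = cycle_edges c.
Proof.
move=> uc; rewrite /cycle_edges.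
have -> : [set [set x; next (rot n c) x] | x in rot n c]
        = [set [set x; next c x] | x in rot n c].
  by apply: eq_imset => x; rewrite next_rot.
apply/setP=> E; apply/imsetP/imsetP => -[x xc ->]; exists x => //.
  by rewrite -(mem_rot n).
by rewrite mem_rot.
Qed.

(** After rotating [x] to the front, its neighbours on the cycle are the two ends of the remaining
    path, and both edges join consecutive vertices of the list. *)
Lemma hole_induced_cycle c : hole c -> induced_cycle e c.
Proof.
move=> hc; split; first exact: hole_graph_cycle.
have /and3P[_ _ uc] := hole_graph_cycle hc.
move=> x y xc yc exy; case: (rot_to xc) => i s E.
rewrite -(cycle_edges_rot i uc) E.
have /hole_rot : hole (rot i c) by apply/hole_rot.
move: yc hc; rewrite -(mem_rot i) -(hole_rot i) E inE => yc [ss ip xN adj] _.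
have ys : y \in s.
  by case/orP: yc => // /eqP yx; rewrite yx e_irr in exy.
move: exy; rewrite (adj y ys) => /orP[]/eqP->.
  apply/imsetP; exists x; first exact: mem_head.
  by case: (s) ss => // z s' _ /=; rewrite eqxx.
apply/imsetP; exists (last x s); first exact: mem_last.
rewrite setUC.
congr [set _; _]; apply/esym/eqP.
have /cycle_next /= : uniq (x :: s) by rewrite /= xN induced_path_uniq.
by rewrite rcons_path => /andP[_].
Qed.
End InducedPaths.

(** * Girth *)

Section HolesOfLengthK.
Variables (T : finType) (e : rel T) (h : nat).
Hypotheses (e_sym : symmetric e) (e_irr : irreflexive e).
Hypotheses (h_ge3 : 2 < h) (G_SC : SC e (2 * h)).

Lemma hole_size c : hole e c -> size c = 2 * h.
Proof.
move=> hc; case: G_SC => [[]|]; first by exists c; apply: hole_graph_cycle.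
by apply; apply: hole_induced_cycle.
Qed.

(** Strong induction on the length: a chordless cycle is induced, and a chord cuts off a shorter
    cycle. *)
Lemma girth c : graph_cycle e c -> 2 * h <= size c.
Proof.
have [n] := ubnP (size c); elim: n c => // n IH c; rewrite ltnS => cn gc.
case: G_SC => [[]|Gk]; first by exists c.
have /and3P[c2 cc uc] := gc.
have [/existsP[x /andP[xc /existsP[y /and3P[yc exy xyN]]]]|noch] :=
  boolP [exists x, (x \in c) && [exists y,
           [&& y \in c, e x y & [set x; y] \notin cycle_edges c]]]; last first.
  rewrite Gk //; split=> // x y xc yc exy; apply: contraNT noch => xyN.
  by apply/existsP; exists x; rewrite xc; apply/existsP; exists y; rewrite yc exy.
have xy : x != y by apply: contraTneq exy => ->; rewrite e_irr.
have [i p q _ _ E] := rot_to_arc uc xc yc xy.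
rewrite -(cycle_edges_rot i uc) E in xyN.
rewrite -(size_rot i c) -(rot_cycle i) -(rot_uniq i) E in cn cc uc *.
have p0 : p != [::].
  apply: contraNneq xyN => ->; apply/imsetP; exists x; first exact: mem_head.
  by rewrite /= eqxx.
have q0 : q != [::].
  apply: contraNneq xyN => q0; move: uc; rewrite q0 => uc.
  apply/imsetP; exists y; first by rewrite inE mem_cat mem_head !orbT.
  rewrite setUC; congr [set _; _]; apply/esym/eqP.
  by have := cycle_next uc; rewrite /= rcons_path last_cat => /andP[].
(* The chord closes the arc [p] into a cycle, which is shorter because [q] is nonempty. *)
suff : 2 * h <= size (x :: rcons p y).
  by move: p0 q0; case: (p) => // a p'; case: (q) => // b q' _ _;
     rewrite /= size_cat size_rcons /=; lia.
apply: IH.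
  move: q0 cn; case: (q) => // b q' _.
  by rewrite /= size_cat size_rcons /=; lia.
apply/and3P; split.
- by case: (p) p0 => // a p' _; rewrite /= size_rcons.
- move: cc; rewrite /= rcons_cat -cat_rcons cat_path => /andP[pp _].
  by rewrite rcons_path pp last_rcons e_sym.
- by move: uc; rewrite -cat_rcons -cat_cons cat_uniq => /and3P[].
Qed.

(** Two different such paths would contain a cycle with fewer than [2 * h] edges: after the common
    initial part, it consists of the pieces up to the first vertex of [p] that lies on [q]. *)
Lemma short_path_uniq x p q :
  path e x p -> path e x q -> uniq (x :: p) -> uniq (x :: q) ->
  last x p = last x q -> size p + size q < 2 * h -> p = q.
Proof.
elim: p x q => [|a p IH] x [|b q] //=.
- by move=> _ _ _ /andP[xN _] E; rewrite E mem_last in xN.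
- by move=> _ _ /andP[xN _] _ E; rewrite -E mem_last in xN.
move=> /andP[exa pp] /andP[exb pq] /andP[xp up] /andP[xq uq] E sz.
case: (a =P b) => [ab|ab].
  by subst b; rewrite (IH a q) //; lia.
exfalso.
have : has (mem (b :: q)) (a :: p).
  by apply/hasP; exists (last a p); rewrite ?mem_last //= E mem_last.
move=> /[dup] hasp; rewrite has_find => fs.
pose i := find (mem (b :: q)) (a :: p).
pose y := nth x (a :: p) i.
have yq : y \in b :: q by apply: (nth_find x hasp).
have p1N v : v \in take i (a :: p) -> v \notin b :: q.
  move=> vi; apply/negP => vq.
  have : has (mem (b :: q)) (take i (a :: p)) by apply/hasP; exists v.
  by rewrite has_take_leq ?ltnn // ltnW.
have pE : a :: p = take i (a :: p) ++ y :: drop i.+1 (a :: p).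
  by rewrite -drop_nth // cat_take_drop.
move: (take i (a :: p)) p1N pE => p1 p1N pE.
move: (drop _ _) pE => p2 pE.
have [q1 [q2 qE]] : exists q1 q2, b :: q = q1 ++ y :: q2.
  by case/splitPr: yq => q1 q2; exists q1, q2.
(* Out along [p1] to [y] and back along [q1]. *)
have gc : graph_cycle e (x :: p1 ++ y :: rev q1).
  apply/and3P; split.
  - rewrite /= size_cat /= size_rev.
    case: (p1) pE (q1) qE => [|? ?] [ap ?] [|? ?] //= [bq ?]; try by lia.
    by case: ab; rewrite ap bq.
  - have xy : path e x (rcons p1 y).
      have : path e x (a :: p) by rewrite /= exa.
      by rewrite pE -cat_rcons cat_path => /andP[].
    have yx : path e y (rcons (rev q1) x).
      have : path e x (b :: q) by rewrite /= exb.
      rewrite qE -cat_rcons cat_path => /andP[+ _].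
      have -> : path e y (rcons (rev q1) x)
          = path e (last x (rcons q1 y)) (rev (belast x (rcons q1 y))).
        by rewrite last_rcons belast_rcons rev_cons.
      rewrite rev_path.
      by apply: sub_path => u v; rewrite e_sym.
    by rewrite /= rcons_cat /= -cat_rcons cat_path xy last_rcons.
  - have := conj xp xq; rewrite pE qE !mem_cat !inE !negb_or => -[xpE xqE].
    have := conj (up : uniq (a :: p)) (uq : uniq (b :: q)); rewrite pE qE !cat_uniq /= => -[upE uqE].
    case/and3P: xpE => x1 x2 _; case/and3P: xqE => x3 _ _.
    case/and3P: upE => u1 /norP[u2 _] _; case/and3P: uqE => u3 /norP[u4 _] _.
    rewrite /= mem_cat inE mem_rev !negb_or x1 x2 x3 cat_uniq u1 /=.
    rewrite mem_rev u4 rev_uniq u3 !andbT negb_or u2 /=.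
    apply/hasPn=> v; rewrite mem_rev => vq1; apply/negP => /p1N.
    by rewrite qE mem_cat vq1.
have := girth gc; have := congr1 size pE; have := congr1 size qE.
by rewrite /= !size_cat /= size_rev; lia.
Qed.

Lemma no_square a b c d :
  a != c -> b != d -> e a b -> e b c -> e c d -> e d a -> False.
Proof.
move=> ac bd ab bc cd da.
have irr u v : e u v -> (u == v) = false.
  by move=> uv; apply: contraTF uv => /eqP->; rewrite e_irr.
have [] : [:: b; c] = [:: d; c].
  have ad : e a d by rewrite e_sym.
  have dc : e d c by rewrite e_sym.
  apply: (@short_path_uniq a) => //=; rewrite ?inE ?ab ?bc ?ad ?dc //; last by lia.
  - by rewrite (irr _ _ ab) (irr _ _ bc) (negbTE ac).
  - by rewrite (irr _ _ ad) (irr _ _ dc) (negbTE ac).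
by move/eqP; rewrite (negbTE bd).
Qed.

Lemma no_triangle a b c : e a b -> e b c -> e c a -> False.
Proof.
have irr u v : e u v -> (u == v) = false.
  by move=> uv; apply: contraTF uv => /eqP->; rewrite e_irr.
move=> ab bc ca; have ac : e a c by rewrite e_sym.
suff : [:: b; c] = [:: c] by [].
apply: (@short_path_uniq a) => //=; rewrite ?inE ?ab ?bc ?ac //; last by lia.
- by rewrite (irr _ _ ab) (irr _ _ bc) (irr _ _ ac).
- by rewrite (irr _ _ ac).
Qed.

Lemma hole_split C c c' :
  hole e C -> c \in C -> c' \in C -> c != c' ->
  exists p q : seq T, hole e (c :: p ++ c' :: q) /\ C =i c :: p ++ c' :: q.
Proof.
move=> hC cC c'C cc'.
have /and3P[_ _ uC] := hole_graph_cycle e_sym hC.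
have [i p q _ _ E] := rot_to_arc uC cC c'C cc'.
exists p, q; rewrite -E; split; first by apply/hole_rot.
by move=> v; rewrite mem_rot.
Qed.

(** The shorter arc between [c] and [c'] has at most [h] edges, and [c x c'] has two. As
    [h + 2 < 2 * h], uniqueness of short paths makes them equal, so [x] would lie on [C]. *)
Lemma hole_nbr_uniq C x c c' :
  hole e C -> x \notin C -> c \in C -> c' \in C -> e x c -> e x c' -> c = c'.
Proof.
move=> hC xN cC c'C xc xc'; apply/eqP; apply: contraT => cc'.
have [p [q [{}hC CE]]] := hole_split hC cC c'C cc'.
rewrite {}CE in xN.
have pq2 : size p + size q + 2 = 2 * h.
  by rewrite -(hole_size hC) /= size_cat /=; lia.
clear cC c'C.
wlog pq : c c' p q xc xc' cc' hC xN pq2 / size p <= size q => [W|].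
  case: (leqP (size p) (size q)) => [|/ltnW] pq; first exact: (W c c' p q).
  apply: (W c' c q p) => //; last by lia.
  - by rewrite eq_sym.
  - exact: hole_swap.
  - by move: xN; rewrite -!cat_cons !mem_cat orbC.
have /and3P[_ cycC uC] := hole_graph_cycle e_sym hC.
have : rcons p c' = [:: x; c'].
  apply: (@short_path_uniq c).
  - by move: cycC; rewrite /= rcons_cat -cat_rcons cat_path => /andP[].
  - by rewrite /= e_sym xc xc'.
  - by move: uC; rewrite -cat_rcons -cat_cons cat_uniq => /and3P[].
  - rewrite /= !inE negb_or cc' !andbT /=.
    move: xN; rewrite inE mem_cat inE !negb_or => /and4P[xc0 _ xc1 _].
    by rewrite eq_sym xc0 xc1.
  - by rewrite last_rcons.
  - by rewrite size_rcons /=; lia.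
case: (p) xN => [|a [|? ?]] //= + [] ax; rewrite ax !inE eqxx orbT //.
Qed.

End HolesOfLengthK.

(** * Attachments of an induced path to an induced cycle *)

Section Attachments.
Variables (T : finType) (e : rel T) (h : nat).
Hypotheses (e_sym : symmetric e) (e_irr : irreflexive e).
Hypotheses (h_ge3 : 2 < h) (G_SC : SC e (2 * h)).

Lemma hole_uniq c : hole e c -> uniq c.
Proof. by move=> /(hole_graph_cycle e_sym) /and3P[]. Qed.

Lemma hole_split3 C c c' c'' :
  hole e C -> c \in C -> c' \in C -> c'' \in C ->
  c != c' -> c != c'' -> c' != c'' ->
  exists p q r : seq T, hole e (c :: p ++ c' :: q ++ c'' :: r) /\
    C =i c :: p ++ c' :: q ++ c'' :: r.
Proof.
move=> hC cC c'C c''C cc' cc'' c'c''.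
have [p [q [{}hC CE]]] := hole_split e_sym hC cC c'C cc'.
move: c''C; rewrite CE inE mem_cat inE !(eq_sym c'').
rewrite (negbTE cc'') (negbTE c'c'') /= => /orP[]/splitPr c''p; last first.
  by case: c''p CE hC => q1 q2 CE hC; exists p, q1, q2.
(* Here [c''] precedes [c']; traversing the cycle backwards from [c] restores the order. *)
case: c''p CE hC => p1 p2 CE hC; exists (rev q), (rev p2), (rev p1).
have E : rev ((p1 ++ c'' :: p2) ++ c' :: q)
       = rev q ++ c' :: rev p2 ++ c'' :: rev p1.
  by rewrite !rev_cat !rev_cons !cat_rcons.
rewrite -E; split; first exact: hole_rev.
by move=> v; rewrite CE !inE mem_rev.
Qed.

(** Only [q] is kept free of edges to [s], so the lemma also applies when [p] contains further
    attachments. *)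
Lemma ear_arc x p y q s :
  hole e (x :: p ++ y :: q) -> p != [::] -> q != [::] -> link e x s y ->
  {in s & q, forall a b, a != b /\ ~~ e a b} -> size s + size q + 2 = 2 * h.
Proof.
move=> hC p0 q0 lk sq.
have exy : ~~ e x y by rewrite (hole_adj hC) negb_or p0.
have xy : x != y.
  by have /andP[+ _] := hole_uniq hC; rewrite mem_cat inE !negb_or => /and3P[].
have lq : link e y q x.
  by apply: (hole_link e_sym q0 (q := p)); apply: hole_swap.
have := hole_size e_sym e_irr G_SC (hole_of_links e_sym lk lq xy exy sq).
by rewrite /= size_cat /=; lia.
Qed.

(** The ear closes an induced cycle with either arc, so any two of [p], [q], [s] together have
    [2 * h - 2] vertices. *)
Lemma ear_size x p y q s :
  hole e (x :: p ++ y :: q) -> link e x s y ->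
  {in s, forall v, v \notin x :: p ++ y :: q} ->
  {in p ++ q, forall c, ~~ has (e c) s} ->
  [\/ p = [::], q = [::] |
     [/\ size p = h.-1, size q = h.-1 & size s = h.-1]].
Proof.
move=> hC lk off cl.
case: (eqVneq p [::]) => [->|p0]; first by constructor.
case: (eqVneq q [::]) => [->|q0]; first by constructor.
have anti (r : seq T) : {subset r <= p ++ q} ->
    {in s & r, forall a b, a != b /\ ~~ e a b}.
  move=> rpq a b aS br; have bpq := rpq b br; split.
    apply: contraNneq (off a aS) => ->.
    by move: bpq; rewrite !(inE, mem_cat) => /orP[] ->; rewrite ?orbT.
  by rewrite e_sym; apply: contra (cl b bpq) => eba; apply/hasP; exists a.
have sq := ear_arc hC p0 q0 lk (anti q _).
have hC' := hole_swap e_sym hC.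
have sp := ear_arc hC' q0 p0 (link_rev e_sym lk) _.
have := hole_size e_sym e_irr G_SC hC; rewrite /= size_cat /= => szC.
constructor 3; have {}sq : size s + size q + 2 = 2 * h.
  by apply: sq => v vq; rewrite mem_cat vq orbT.
have {}sp : size s + size p + 2 = 2 * h.
  rewrite -(size_rev s); apply: sp => a b; rewrite mem_rev => aS bp.
  by apply: (anti p) => // v vp; rewrite mem_cat vp.
by split; lia.
Qed.

(* In the configuration of [no_three_attachments] below.  If [q] is empty and
   [size s = h], then c', the (h-1)-st and the last vertex of s, and c'' form a
   4-cycle. *)
Lemma first_attachment c p c' q c'' r s :
  hole e (c :: p ++ c' :: q ++ c'' :: r) -> induced_path e s -> 1 < size s ->
  {in s, forall v, v \notin c :: p ++ c' :: q ++ c'' :: r} ->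
  {in s, forall v, e c v = (v == head c s)} ->
  {in s, forall v, e c'' v = (v == last c s)} ->
  has (e c') s -> {in p ++ q ++ r, forall d, ~~ has (e d) s} ->
  p = [::] \/ size p = h.-1 /\ (q = [::] -> size s <> h).
Proof.
move=> hC ips s2 off adjc adjc'' c's cl.
have uC := hole_uniq hC.
have [cc'' c'c''] : c != c'' /\ c' != c''.
  move: uC; rewrite /= cat_uniq /= => /and5P[cN _ _ c'N _]; split.
    by apply: contraNneq cN => ->; rewrite mem_cat inE mem_cat inE eqxx !orbT.
  by apply: contraNneq c'N => ->; rewrite mem_cat inE eqxx !orbT.
(* [t] is the first neighbour of [c'] on [s]; the initial part [rcons a t] is an ear from [c] to
   [c']. *)
have [a [t [b [sE c't c'a]]]] : exists a t b,
    [/\ s = a ++ t :: b, e c' t & ~~ has (e c') a].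
  by case: (split_find c's) => t a b c't c'a; exists a, t, b; rewrite cat_rcons.
have us := induced_path_uniq ips.
have ts : t \in s by rewrite sE mem_cat mem_head orbT.
have lastE : last c s \in s by case: (s) s2 => //= z s' _; apply: mem_last.
(* The last vertex of [s] already has the neighbour [c''] on the cycle, and it can have only one. *)
have tlast : t != last c s.
  apply: contra_neq c'c'' => tE.
  apply: (hole_nbr_uniq e_sym e_irr h_ge3 G_SC hC (off t ts)).
  - by rewrite inE mem_cat inE eqxx !orbT.
  - by rewrite inE mem_cat inE mem_cat inE eqxx !orbT.
  - by rewrite e_sym.
  - by rewrite e_sym adjc'' // tE.
have ip1 : induced_path e (rcons a t).
  by move: ips; rewrite sE -cat_rcons => /induced_path_cat[].
have sub1 : {subset rcons a t <= s}.
  by move=> v; rewrite sE -cat_rcons mem_cat => ->.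
have b0 : b != [::].
  by apply: contraNneq tlast => b0; rewrite sE b0 last_cat.
have lk : link e c (rcons a t) c'.
  split=> //; first by case: (a).
  - split; apply/negP => /sub1/off; first by rewrite mem_head.
    by rewrite inE mem_cat inE eqxx !orbT.
  - move=> v vs; rewrite adjc ?sub1 // last_rcons; split.
      by rewrite sE; case: (a).
    move: vs; rewrite mem_rcons inE => /orP[/eqP->|va]; first by rewrite eqxx.
    rewrite [v == t](_ : _ = false); last first.
      apply/negP => /eqP vt; move: us; rewrite sE cat_uniq => /and3P[_ /hasPn/(_ t (mem_head _ _))].
      by rewrite -vt va.
    by apply/negP => c'v; move/hasP: c'a; case; exists v.
(* The ear ends before the last vertex of [s], so [c''] is not attached to it, and neither is any
   other inner vertex of the two arcs. *)
have := ear_size hC lk _ _.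
case.
- by move=> v /sub1 /off.
- move=> d; rewrite mem_cat mem_cat inE => dD.
  have : ~~ has (e d) s \/ d = c''.
    case/or4P: dD => [dp|dq|/eqP->|dr]; [left|left|by right|left];
      by apply: cl; rewrite !mem_cat ?dp ?dq ?dr ?orbT.
  case=> [ns|->].
    by apply: contra ns => /hasP[v /sub1 vs dv]; apply/hasP; exists v.
  apply/hasP => -[v vs]; rewrite adjc'' ?sub1 // => /eqP vl.
  move: us; rewrite sE -cat_rcons cat_uniq => /and3P[_ /hasPn/(_ v) + _].
  rewrite vs => /(_ _)/negP; apply => //; rewrite vl sE last_cat /=.
  by case: (b) b0 => //= z b' _; apply: mem_last.
- by left.
- by case: (q).
case=> sp _ sa; right; split=> // q0 sh.
(* The ear has [h - 1] vertices and [s] has [h], so exactly one vertex of [s] follows [t]. *)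
have [y bE] : exists y, b = [:: y].
  have : size b = 1.
    by move: sh sa; rewrite sE size_cat size_rcons /=; clear -h_ge3; lia.
  by case: (b) => // y [|? ?] // _; exists y.
have ty : e t y.
  move: ips; rewrite sE bE => /induced_path_cat[_ + _].
  by move/(induced_path_path); rewrite /= andbT.
have ys : y \in s by rewrite sE bE mem_cat !inE eqxx !orbT.
have c''y : e c'' y by rewrite adjc'' // sE bE last_cat /= eqxx.
apply: (no_square e_sym e_irr h_ge3 G_SC (a := c') (b := t) (c := y) (d := c'')).
- apply: contraTneq ys => <-.
  by apply/negP=> /off; rewrite inE mem_cat inE eqxx !orbT.
- apply: contraTneq ts => ->.
  by apply/negP=> /off; rewrite inE mem_cat inE mem_cat inE eqxx !orbT.
- by [].
- by [].
- by rewrite e_sym.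
- have := hole_swap e_sym hC; rewrite q0 e_sym => hC'.
  by rewrite (hole_adj (p := [::]) hC').
Qed.

(* The shape of a shortest counterexample to [card_attachments]: c is attached
   only to the first vertex of s, c'' only to the last one. *)
Lemma no_three_attachments c p c' q c'' r s :
  hole e (c :: p ++ c' :: q ++ c'' :: r) -> induced_path e s -> 1 < size s ->
  {in s, forall v, v \notin c :: p ++ c' :: q ++ c'' :: r} ->
  {in s, forall v, e c v = (v == head c s)} ->
  {in s, forall v, e c'' v = (v == last c s)} ->
  has (e c') s -> {in p ++ q ++ r, forall d, ~~ has (e d) s} -> False.
Proof.
move=> hC ips s2 off adjc adjc'' c's cl.
have headE : head c'' s = head c s by case: (s) s2.
have lastE : last c'' s = last c s by case: (s) s2.
have revE : rev (p ++ c' :: q ++ c'' :: r)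
          = rev r ++ c'' :: rev q ++ c' :: rev p.
  by rewrite !(rev_cat, rev_cons) !cat_rcons -!catA.
(* Reading everything backwards exchanges [c] with [c''] and [p] with [q]. *)
have hR : hole e (c'' :: rev q ++ c' :: rev p ++ c :: rev r).
  have := hole_rev e_sym hC; rewrite revE => /(hole_swap e_sym).
  by rewrite -catA.
have DE : c'' :: rev q ++ c' :: rev p ++ c :: rev r
       =i c :: p ++ c' :: q ++ c'' :: r.
  move=> v; rewrite !(inE, mem_cat, mem_rev).
  by case: (v == c) (v == c') (v == c'') (v \in p) (v \in q) (v \in r)
    => [] [] [] [] [] [].
have szC := hole_size e_sym e_irr G_SC hC.
rewrite /= size_cat /= size_cat /= in szC.
have [offR adjcR adjc''R] : [/\ {in rev s, forall v,
     v \notin c'' :: rev q ++ c' :: rev p ++ c :: rev r},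
   {in rev s, forall v, e c'' v = (v == head c'' (rev s))} &
   {in rev s, forall v, e c v = (v == last c'' (rev s))}].
  split=> v; rewrite mem_rev => vs; first by rewrite DE off.
    by rewrite head_rev lastE adjc''.
  by rewrite last_rev headE adjc.
have clR : {in rev q ++ rev p ++ rev r, forall d, ~~ has (e d) (rev s)}.
  move=> d dD; rewrite has_rev; apply: cl; move: dD.
  by rewrite !(mem_cat, mem_rev) orbCA.
have ipR := induced_path_rev e_sym ips.
have sR : 1 < size (rev s) by rewrite size_rev.
have c'R : has (e c') (rev s) by rewrite has_rev.
(* [s] and the arc [r], which avoids [c'], form an induced cycle. *)
have sr : r != [::] -> size s + size r + 2 = 2 * h.
  move=> r0; have hC2 : hole e (c'' :: r ++ c :: p ++ c' :: q).
    by apply: (hole_swap e_sym (p := p ++ c' :: q)); rewrite -catA.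
  have := @ear_arc c (p ++ c' :: q) c'' r s; rewrite -catA; apply=> //.
  - by case: (p).
  - split=> //; first by case: (s) s2.
      split; apply/negP => /off; first by rewrite mem_head.
      by rewrite inE mem_cat inE mem_cat inE eqxx !orbT.
    by move=> v vs; rewrite adjc // adjc''.
  - move=> a b aS br; split.
      apply: contraNneq (off a aS) => ->.
      by rewrite !(inE, mem_cat) br !orbT.
    have : ~~ has (e b) s by apply: cl; rewrite !mem_cat br !orbT.
    by apply: contra; rewrite e_sym => eba; apply/hasP; exists a.
have pd := first_attachment hC ips s2 off adjc adjc'' c's cl.
have qd := first_attachment hR ipR sR offR adjcR adjc''R c'R clR.
rewrite !size_rev in qd.
(* [p] and [q] have 0 or [h - 1] vertices each, and the three arcs have [2 * h - 3] in all. For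
   empty [r] this is impossible. Otherwise [size s = size p + size q + 1], and each case contradicts
   [1 < size s], [size s <> h] or the total. *)
have [r0|r0] := eqVneq r [::].
  move: szC; rewrite r0 /=.
  case: pd => [->|[-> _]]; case: qd => [/(congr1 size)|[-> _]];
    rewrite ?size_rev /=; lia.
have := sr r0; case: pd => [p0|[ph pd]]; case: qd => [/(congr1 size)|[qh qd]].
- by rewrite size_rev /= => q0; move: szC; rewrite p0 q0 /=; lia.
- by move=> _; apply: qd; rewrite ?p0 //; move: szC; rewrite p0 qh /=; lia.
- rewrite size_rev => /size0nil q0 _; apply: pd => //.
  by move: szC; rewrite q0 ph /=; lia.
- by move: szC r0; rewrite ph qh; case: (r) => //= ? ? ; lia.
Qed.

(** Dropping the first vertex of [s] loses an attachment [c], which therefore sees only that vertex.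
    That vertex has no other neighbour on [C], so every other attachment survives. *)
Lemma attached_to_head C s n :
  hole e C -> induced_path e s -> {in s, forall v, v \notin C} ->
  #|[set c in C | has (e c) (behead s)]| <= n ->
  n < #|[set c in C | has (e c) s]| ->
  exists c, [/\ c \in C, has (e c) s, {in s, forall v, e c v = (v == head c s)}
    & {in C, forall d, d != c -> has (e d) s -> has (e d) (behead s)}].
Proof.
move=> hC ips off Nb Ns.
have /subsetPn[c] : ~~ ([set c in C | has (e c) s]
                     \subset [set c in C | has (e c) (behead s)]).
  apply: contraL Ns => /subset_leq_card sub.
  by rewrite -leqNgt (leq_trans sub).
case: s ips off {Nb Ns} => [|x s] ips off; first by rewrite !inE andbF.
rewrite !inE /= => /andP[cC]; rewrite cC /= => cs cN.
have cx : e c x by case/orP: cs cN => // ->.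
exists c; split=> //=.
  move=> v; rewrite inE => /orP[/eqP->|vs]; first by rewrite eqxx.
  have /andP[xs _] := induced_path_uniq ips.
  rewrite [v == x](_ : _ = false); last by apply: contraNF xs => /eqP<-.
  by apply: contraNF cN => cv; apply/hasP; exists v.
move=> d dC dc /orP[dx|//]; case/eqP: dc.
apply: (hole_nbr_uniq e_sym e_irr h_ge3 G_SC hC (off x (mem_head _ _))) => //.
  by rewrite e_sym.
by rewrite e_sym.
Qed.

(** A shortest counterexample loses an attachment when either end vertex is dropped: this gives [c]
    and [c'']. There is a third attachment [c'] but no fourth, since otherwise three would remain
    after dropping the first vertex. This is the configuration of [no_three_attachments]. *)
Lemma card_attachments C s :
  hole e C -> induced_path e s -> {in s, forall v, v \notin C} ->
  #|[set c in C | has (e c) s]| <= 2.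
Proof.
move=> hC; have [n] := ubnP (size s); elim: n s => // n IH s.
rewrite ltnS => sn ips off; rewrite leqNgt; apply/negP => N3.
(* Stated for every list of the same length, so as to apply to [rev s] as well. *)
have IHs t : induced_path e t -> size t = size s ->
    {in t, forall v, v \notin C} ->
    #|[set c in C | has (e c) (behead t)]| <= 2.
  case: t => [|x t] /= ipt ts offt.
    by rewrite (_ : [set c in C | false] = set0) ?cards0 //; apply/setP=> v; rewrite !inE andbF.
  apply: IH; first by lia.
    by case/and3P: ipt.
  by move=> v vt; apply: offt; rewrite inE vt orbT.
have [c [cC cs adjc cb]] := attached_to_head hC ips off (IHs _ ips erefl off) N3.
have ipR := induced_path_rev e_sym ips.
have offR : {in rev s, forall v, v \notin C} by move=> v; rewrite mem_rev => /off.
have N3R : 2 < #|[set c in C | has (e c) (rev s)]|.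
  rewrite (_ : [set c in C | has (e c) (rev s)] = [set c in C | has (e c) s]) //.
  by apply/setP => v; rewrite !inE has_rev.
have [c'' [c''C c''s adjc'' c''b]] :=
  attached_to_head hC ipR offR (IHs _ ipR (size_rev _) offR) N3R.
rewrite has_rev in c''s.
have /subsetPn[c'] : ~~ ([set c in C | has (e c) s] \subset [set c; c'']).
  apply: contraL N3 => /subset_leq_card sub.
  by rewrite -leqNgt (leq_trans sub) // cards2; case: (_ != _).
rewrite !inE => /andP[c'C c's] /norP[c'c c'c''].
have s2 : 1 < size s.
  by have := cb _ c'C c'c c's; case: (s) => [|? []].
have {}adjc'' : {in s, forall v, e c'' v = (v == last c s)}.
  move=> v vs; rewrite adjc'' ?mem_rev // head_rev.
  by case: (s) s2.
have cc'' : c != c''.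
  case: (s) s2 (induced_path_uniq ips) adjc adjc'' => //= x s' s2 /andP[xs' _] adjc adjc''.
  apply: contraNneq xs' => cE; have := adjc'' x (mem_head _ _).
  rewrite -cE adjc ?mem_head // eqxx => /esym/eqP {1}->.
  by case: (s') s2 => //= y s'' _; apply: mem_last.
have [p [q [r [hD CD]]]] : exists p q r : seq T,
    hole e (c :: p ++ c' :: q ++ c'' :: r) /\
    C =i c :: p ++ c' :: q ++ c'' :: r.
  by apply: hole_split3 => //; rewrite eq_sym.
apply: (no_three_attachments hD ips s2 _ adjc adjc'' c's).
  by move=> v /off; rewrite CD.
move=> d dD; apply/negP => ds.
have [dC dc dc' dc''] : [/\ d \in C, d != c, d != c' & d != c''].
  have : uniq (c :: c' :: c'' :: p ++ q ++ r).
    rewrite -(perm_uniq (s1 := c :: p ++ c' :: q ++ c'' :: r)) ?(hole_uniq hD) //.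
    apply/permP => P; rewrite /= !count_cat /= !count_cat /=.
    move: (nat_of_bool (P c)) (nat_of_bool (P c')) (nat_of_bool (P c'')).
    move: (count P p) (count P q) (count P r) => i j l u v w.
    by clear; lia.
  rewrite /= !inE !negb_or => /and4P[/and3P[_ _ dc] /andP[_ dc'] dc'' _].
  have neq x : x \notin p ++ q ++ r -> d != x by apply: contraNneq => <-.
  split; [|exact: neq..]; rewrite CD; move: dD.
  rewrite !(inE, mem_cat) => /or3P[] ->; rewrite ?orbT //.
have := IHs s ips erefl off; apply/negP; rewrite -ltnNge.
have /subset_leq_card : [set c'; c''; d] \subset [set c in C | has (e c) (behead s)].
  apply/subsetP => v; rewrite !inE => /orP[/orP[]|] /eqP->.
  - by rewrite c'C cb.
  - by rewrite c''C cb // eq_sym.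
  - by rewrite dC cb.
by apply: leq_trans; rewrite setUC cardsU1 cards2 !inE negb_or dc' dc'' c'c''.
Qed.

End Attachments.

(** * Attachments of a connected set *)

Section ConnectedSets.
Variables (T : finType) (e : rel T).
Hypotheses (e_sym : symmetric e) (e_irr : irreflexive e).

Definition restrict (X : {set T}) : rel T :=
  [rel u v | [&& u \in X, v \in X & e u v]].

Definition connected_in (X : {set T}) : Prop :=
  {in X &, forall u v, connect (restrict X) u v}.

Lemma split_last (a : pred T) s : has a s ->
  exists s1 t s2, [/\ s = s1 ++ t :: s2, a t & ~~ has a s2].
Proof.
rewrite -has_rev => ha; rewrite -[s]revK.
case: (split_find ha) => t s1 s2 at_ s1N.
by exists (rev s2), t, (rev s1); rewrite rev_cat rev_rcons has_rev.
Qed.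

(** Greedy shortening: given an induced path for the tail, start at [x] if [x] lies on it, and
    otherwise jump from [x] to its last neighbour there. *)
Lemma induced_subpath x p : path e x p ->
  exists p', [/\ induced_path e (x :: p'), last x p' = last x p
    & {subset p' <= p}].
Proof.
elim: p x => [|y p IH] x /=; first by exists [::].
move=> /andP[exy /IH[p' [ip' lp' sub]]].
have sub' : {subset y :: p' <= y :: p}.
  by move=> v; rewrite !inE => /orP[->//|/sub->]; rewrite orbT.
have [xp|xp] := boolP (x \in y :: p').
  have [a [b E]] : exists a b, y :: p' = a ++ x :: b.
    by case/splitPr: xp => a b; exists a, b.
  exists b; split.
  - by move: ip'; rewrite E => /induced_path_cat[].
  - by rewrite -lp' -[last y p']/(last y (y :: p')) E last_cat.
  - by move=> v vb; apply: sub'; rewrite E mem_cat inE vb !orbT.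
have [|a [t [b [E ext bN]]]] := @split_last (e x) (y :: p').
  by rewrite /= exy.
have ipb : induced_path e (t :: b).
  by move: ip'; rewrite E => /induced_path_cat[].
exists (t :: b); split.
- rewrite /= in ipb *; rewrite ipb andbT ext eqxx /=; apply/andP; split.
    by apply: contra xp; rewrite E mem_cat => ->; rewrite orbT.
  apply/allP => v vb; case/and3P: ipb => tb _ _.
  rewrite [v == t](_ : _ = false); last by apply: contraNF tb => /eqP<-.
  by rewrite eqbF_neg; apply: contra bN => xv; apply/hasP; exists v.
- by rewrite -lp' -[last y p']/(last y (y :: p')) E last_cat.
- by move=> v vb; apply: sub'; rewrite E mem_cat vb orbT.
Qed.

(** On an induced path in [X] from [u] to [v], keep the part from the last neighbour of [x] to the
    first neighbour of [y] from there on. *)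
Lemma link_exists X x y u v :
  connected_in X -> x \notin X -> y \notin X ->
  u \in X -> e x u -> v \in X -> e y v ->
  exists2 s, {subset s <= X} & link e x s y.
Proof.
move=> cX xX yX uX xu vX yv.
have [p pp lp] := connectP (cX u v uX vX).
have subp : {subset u :: p <= X}.
  move=> w; rewrite inE => /orP[/eqP->//|].
  elim: (p) (u) pp => //= a p' IH b /andP[/and3P[_ aX _] /IH pX].
  by rewrite inE => /orP[/eqP->|].
have {}pp : path e u p by apply: sub_path pp => a b /and3P[].
have [p' [ip' lp' sub]] := induced_subpath pp.
have subX : {subset u :: p' <= X}.
  move=> w; rewrite inE => /orP[/eqP->//|/sub wp].
  by apply: subp; rewrite inE wp orbT.
have [|a [t [b [E xt bN]]]] := @split_last (e x) (u :: p').
  by rewrite /= xu.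
have ipb : induced_path e (t :: b).
  by move: ip'; rewrite E => /induced_path_cat[].
have : has (e y) (t :: b).
  apply/hasP; exists v => //; rewrite lp -lp' -[last u p']/(last u (u :: p')).
  by rewrite E last_cat /= mem_last.
move=> hb; have [c [w [d [E' yw cN]]]] : exists c w d,
    [/\ t :: b = c ++ w :: d, e y w & ~~ has (e y) c].
  by case: (split_find hb) => w c d *; exists c, w, d; rewrite cat_rcons.
have subs : {subset rcons c w <= t :: b}.
  by move=> z; rewrite E' -cat_rcons mem_cat => ->.
have subsX : {subset rcons c w <= X}.
  by move=> z /subs zb; apply: subX; rewrite E mem_cat zb orbT.
have ub := induced_path_uniq ipb.
exists (rcons c w) => //; split.
- by case: (c).
- by move: ipb; rewrite E' -cat_rcons => /induced_path_cat[].
- by split; [apply: contra xX | apply: contra yX] => /subsX.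
move=> z zs; split.
  have -> : head x (rcons c w) = t.
    by case: (c) E' => [|c0 c'] /= [->].
  have := subs z zs; rewrite inE => /orP[/eqP->|zb]; first by rewrite eqxx.
  rewrite [z == t](_ : _ = false); last first.
    by case/andP: ub => tb _; apply: contraNF tb => /eqP<-.
  by apply: contraNF bN => xz; apply/hasP; exists z.
rewrite last_rcons; move: zs; rewrite mem_rcons inE => /orP[/eqP->|zc].
  by rewrite eqxx.
rewrite [z == w](_ : _ = false).
  by apply: contraNF cN => yz; apply/hasP; exists z.
apply/negP => /eqP zw; move: ub; rewrite E' cat_uniq.
by move=> /and3P[_ /hasPn/(_ w (mem_head _ _)) + _]; rewrite -zw zc.
Qed.

Lemma connect_sub_set (X Y : {set T}) u v :
  X \subset Y -> connect (restrict X) u v -> connect (restrict Y) u v.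
Proof.
move=> /subsetP XY; apply: connect_sub => a b /and3P[aX bX ab].
by apply: connect1; rewrite /restrict /= !XY.
Qed.

Lemma connected_inU (X Y : {set T}) x y :
  connected_in X -> connected_in Y -> x \in X -> y \in Y ->
  (x == y) || e x y -> connected_in (X :|: Y).
Proof.
move=> cX cY xX yY xy.
have symXY : connect_sym (restrict (X :|: Y)).
  by apply: sym_connect_sym => a b; rewrite /restrict /= andbCA e_sym.
have to_x u : u \in X :|: Y -> connect (restrict (X :|: Y)) u x.
  rewrite inE => /orP[uX|uY].
    by apply: connect_sub_set (cX u x uX xX); apply: subsetUl.
  apply: (connect_trans (y := y)).
    by apply: connect_sub_set (cY u y uY yY); apply: subsetUr.
  case/orP: xy => [/eqP->|xy]; first exact: connect0.
  by apply: connect1; rewrite /restrict /= !inE yY xX orbT e_sym.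
move=> u v uXY vXY; apply: connect_trans (to_x u uXY) _.
by rewrite symXY; apply: to_x.
Qed.

Lemma connected_in_path x p : path e x p -> connected_in [set v in x :: p].
Proof.
elim: p x => [|y p IH] x /=.
  by move=> _ u v; rewrite !inE => /eqP-> /eqP->; apply: connect0.
move=> /andP[xy /IH cp].
rewrite (_ : [set v in _] = [set x] :|: [set v in y :: p]); last first.
  by apply/setP => v; rewrite !inE.
apply: (connected_inU (x := x) (y := y)) => //; rewrite ?inE ?eqxx ?xy ?orbT //.
by move=> u v; rewrite !inE => /eqP-> /eqP->; apply: connect0.
Qed.

Lemma connected_in_link x s y : link e x s y -> connected_in [set v in s].
Proof.
case: s => [|a s]; case=> // _ ip _ _.
by apply: connected_in_path; apply: induced_path_path.
Qed.

Lemma link_ends x s y : link e x s y ->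
  [/\ head x s \in s, e x (head x s), last x s \in s & e y (last x s)].
Proof.
case: s => [|a s]; case=> // _ _ _ adj.
have [-> _] := adj a (mem_head _ _).
have [_ ->] := adj (last a s) (mem_last _ _).
by rewrite /= mem_head mem_last !eqxx.
Qed.

End ConnectedSets.

(** * Ears of an induced cycle and their ends *)

Section Crossing.
Variables (T : finType) (e : rel T) (h : nat).
Hypotheses (e_sym : symmetric e) (e_irr : irreflexive e).
Hypotheses (h_ge3 : 2 < h) (G_SC : SC e (2 * h)).

(** The ends [c] and [c'] already exhaust the two attachments allowed by [card_attachments]. *)
Lemma link_attachments C c s c' d :
  hole e C -> link e c s c' -> {in s, forall v, v \notin C} ->
  c \in C -> c' \in C -> c != c' -> d \in C -> has (e d) s ->
  d = c \/ d = c'.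
Proof.
move=> hC lk off cC c'C cc' dC ds.
have [hs ch ls c'l] := link_ends lk; case: lk => _ ips _ _.
case: (eqVneq d c) => [|dc]; first by left.
case: (eqVneq d c') => [|dc']; first by right.
have := card_attachments e_sym e_irr h_ge3 G_SC hC ips off.
have /subset_leq_card : [set d; c; c'] \subset [set c in C | has (e c) s].
  apply/subsetP => v; rewrite !inE => /orP[/orP[]|] /eqP->.
  - by rewrite dC ds.
  - by rewrite cC; apply/hasP; exists (head c s).
  - by rewrite c'C; apply/hasP; exists (last c s).
by rewrite -setUA cardsU1 cards2 !inE negb_or dc dc' cc' => H /(leq_trans H).
Qed.

Lemma ear_size_clean x p y q s :
  hole e (x :: p ++ y :: q) -> link e x s y ->
  {in s, forall v, v \notin x :: p ++ y :: q} ->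
  [\/ p = [::], q = [::] |
     [/\ size p = h.-1, size q = h.-1 & size s = h.-1]].
Proof.
move=> hC lk off.
apply: (ear_size e_sym e_irr h_ge3 G_SC hC lk off) => d dpq; apply/negP => ds.
have yC : y \in x :: p ++ y :: q by rewrite inE mem_cat inE eqxx !orbT.
have dC : d \in x :: p ++ y :: q.
  by move: dpq; rewrite !(inE, mem_cat) => /orP[] ->; rewrite ?orbT.
have := hole_uniq e_sym hC; rewrite /= cat_uniq /= mem_cat inE !negb_or.
move=> /and5P[/and3P[xp xy xq] _ /andP[yp _] yq _].
have [dx|dy] := link_attachments hC lk off (mem_head _ _) yC xy dC ds.
- by move: dpq; rewrite dx mem_cat (negbTE xp) (negbTE xq).
- by move: dpq; rewrite dy mem_cat (negbTE yp) (negbTE yq).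
Qed.

(** Any two of the three vertices are the ends of an ear in [X], so each of the three arcs between
    them has 0 or [h - 1] inner vertices. These numbers cannot add up to [2 * h - 3]. *)
Lemma no_three_attachments_set C X a b c :
  hole e C -> connected_in e X -> {in X, forall v, v \notin C} ->
  a \in C -> b \in C -> c \in C -> a != b -> a != c -> b != c ->
  (exists2 v, v \in X & e a v) -> (exists2 v, v \in X & e b v) ->
  (exists2 v, v \in X & e c v) -> False.
Proof.
move=> hC cX off aC bC cC ab ac bc aX bX cX'.
have [p [q [r [{}hC CE]]]] := hole_split3 e_sym hC aC bC cC ab ac bc.
have {}off : {in X, forall v, v \notin a :: p ++ b :: q ++ c :: r}.
  by move=> v /off; rewrite CE.
(* In each use [q'] contains the third vertex and so is nonempty. *)
have arc x p' y q' : hole e (x :: p' ++ y :: q') ->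
    x :: p' ++ y :: q' =i a :: p ++ b :: q ++ c :: r -> q' != [::] ->
    (exists2 v, v \in X & e x v) -> (exists2 v, v \in X & e y v) ->
    size p' = 0 \/ size p' = h.-1.
  move=> hC' CE' q0 [u uX xu] [v vX yv].
  have offX z : z \in x :: p' ++ y :: q' -> z \notin X.
    by rewrite CE' => zC; apply/negP => /off; rewrite zC.
  have [s sX lk] : exists2 s, {subset s <= X} & link e x s y.
    apply: (link_exists cX _ _ uX xu vX yv); apply: offX.
      exact: mem_head.
    by rewrite inE mem_cat inE eqxx !orbT.
  have [|->|q'0|[-> _ _]] := ear_size_clean hC' lk.
  - by move=> z /sX zX; rewrite CE' off.
  - by left.
  - by rewrite q'0 in q0.
  - by right.
have h2 : hole e (b :: q ++ c :: (r ++ a :: p)).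
  by have := hole_swap e_sym hC; rewrite -catA.
have h3 : hole e (c :: r ++ a :: (p ++ b :: q)).
  by have := hole_swap e_sym h2; rewrite -catA.
have := hole_size e_sym e_irr G_SC hC.
rewrite /= size_cat /= size_cat /= => szC.
have nonnil (u w : seq T) z : u ++ z :: w != [::] by case: u.
have sp := arc _ _ _ _ hC (fun=> erefl) (nonnil _ _ _) aX bX.
have sq : size q = 0 \/ size q = h.-1.
  apply: (arc _ _ _ _ h2) => // v; rewrite !(inE, mem_cat).
  by case: (v == a) (v == b) (v == c) (v \in p) (v \in q) (v \in r)
    => [] [] [] [] [] [].
have sr : size r = 0 \/ size r = h.-1.
  apply: (arc _ _ _ _ h3) => // v; rewrite !(inE, mem_cat).
  by case: (v == a) (v == b) (v == c) (v \in p) (v \in q) (v \in r)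
    => [] [] [] [] [] [].
by move: szC sp sq sr; clear -h_ge3; lia.
Qed.

(** By [ear_size_clean] the ends of each ear are opposite on [C]. If the two pairs differed, a
    connected set containing [s'] would attach to [w], [z] and [w'] on some induced cycle. Reversing
    [s'] gives the same conclusion for [z']. *)
Lemma ear_off_ends C w s z w' s' z' :
  hole e C -> link e w s z -> link e w' s' z' ->
  {in s, forall v, v \notin C} -> {in s', forall v, v \notin C} ->
  w \in C -> z \in C -> w' \in C -> z' \in C ->
  w != z -> ~~ e w z -> w' != z' -> ~~ e w' z' -> w' = w \/ w' = z.
Proof.
move=> hC lk lk' off off' wC zC w'C z'C wz ewz w'z' ew'z'.
case: (eqVneq w' w) => [|w'w]; first by left.
case: (eqVneq w' z) => [|w'z]; first by right.
exfalso.
have [hs wh ls zl] := link_ends lk.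
have [hs' wh' ls' zl'] := link_ends lk'.
have [a [b [hD CE]]] := hole_split e_sym hC wC zC wz.
(* Reversing the cycle exchanges the arcs [a] and [b]. *)
wlog w'a : a b hD CE / w' \in a.
  move=> W; have : w' \in a \/ w' \in b.
    move: w'C; rewrite CE inE mem_cat inE (negbTE w'w) (negbTE w'z) /=.
    by move/orP.
  case; first exact: W hD CE.
  move=> w'b; have E : w :: rev (a ++ z :: b) = w :: rev b ++ z :: rev a.
    by rewrite rev_cat rev_cons cat_rcons.
  apply: (W (rev b) (rev a)).
  - by rewrite -E; apply: hole_rev.
  - by rewrite -E => v; rewrite CE !inE mem_rev.
  - by rewrite mem_rev.
have offD : {in s, forall v, v \notin w :: a ++ z :: b}.
  by move=> v /off; rewrite CE.
have [a0 b0] : a != [::] /\ b != [::].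
  by apply/andP; rewrite -negb_or -(hole_adj hD).
have [sa sb ss] : [/\ size a = h.-1, size b = h.-1 & size s = h.-1].
  by case: (ear_size_clean hD lk offD) => [E|E|//]; rewrite E in a0 b0.
have := hole_uniq e_sym hD; rewrite /= cat_uniq /= mem_cat inE !negb_or.
move=> /and5P[/and3P[wa _ wb] ua /andP[za /hasPn ab] zb ub].
(* [z'] is opposite to [w'], hence on the other arc. *)
have b_z' : z' \in b.
  have [a1 [a2 aE]] : exists a1 a2, a = a1 ++ w' :: a2.
    by case/splitPr: w'a => a1 a2; exists a1, a2.
  have hE : hole e (w' :: a2 ++ z :: b ++ w :: a1).
    have := hole_swap e_sym (x := w) (p := a1) (y := w') (q := a2 ++ z :: b).
    by rewrite -!catA; apply; move: hD; rewrite aE -catA.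
  have EC : w' :: a2 ++ z :: b ++ w :: a1 =i C.
    move=> v; rewrite CE aE !(inE, mem_cat, inE).
    by case: (v == w) (v == w') (v == z) (v \in a1) (v \in a2) (v \in b)
      => [] [] [] [] [] [].
  have : z' \in a2 ++ z :: b ++ w :: a1.
    by move: z'C; rewrite -EC inE eq_sym (negbTE w'z').
  move=> z'E; have [p [q pqE]] : exists p q, a2 ++ z :: b ++ w :: a1 = p ++ z' :: q.
    by case/splitPr: z'E => p q; exists p, q.
  rewrite pqE in hE EC.
  have off'E : {in s', forall v, v \notin w' :: p ++ z' :: q}.
    by move=> v /off'; rewrite EC.
  have [p0 q0] : p != [::] /\ q != [::].
    by apply/andP; rewrite -negb_or -(hole_adj hE).
  have [sp _ _] : [/\ size p = h.-1, size q = h.-1 & size s' = h.-1].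
    by case: (ear_size_clean hE lk' off'E) => [E|E|//]; rewrite E in p0 q0.
  (* [z'] has index [h - 1] in the list after [w']; skipping [a2] and [z] leaves index [size a1] in
     [b]. *)
  have := congr1 (fun l => nth z l h.-1) pqE.
  rewrite [RHS]nth_cat sp ltnn subnn /= => <-.
  have sa12 := sa; rewrite aE size_cat /= in sa12.
  rewrite nth_cat ifF; last by move: sa12 h_ge3; clear; lia.
  rewrite (_ : h.-1 - size a2 = (size a1).+1) /=; last first.
    by move: sa12 h_ge3; clear; lia.
  have a1b : size a1 < size b by rewrite sb; move: sa12 h_ge3; clear; lia.
  by rewrite nth_cat a1b mem_nth.
have w'z'X (X : {set T}) : [set v in s'] \subset X ->
    (exists2 v, v \in X & e w' v) /\ (exists2 v, v \in X & e z' v).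
  move=> /subsetP sX; split.
    by exists (head w' s') => //; apply: sX; rewrite inE.
  by exists (last w' s') => //; apply: sX; rewrite inE.
have cs' := connected_in_link e_sym lk'.
(* If the ears meet, their union is connected and attaches to [w], [z] and [w'] on [C]. *)
have [/hasP[v vs' vs]|/hasPn dis] := boolP (has (mem s) s').
  have cX : connected_in e ([set v in s] :|: [set v in s']).
    apply: (connected_inU e_sym (x := v) (y := v)) => //; rewrite ?inE ?eqxx //.
    exact: connected_in_link lk.
  have [w'X _] := w'z'X _ (subsetUr [set v in s] [set v in s']).
  apply: (no_three_attachments_set hC cX _ wC zC w'C wz _ _ _ _ w'X).
  - by move=> u; rewrite !inE => /orP[/off|/off'].
  - by rewrite eq_sym.
  - by rewrite eq_sym.
  - by exists (head w s); rewrite ?inE ?hs.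
  - by exists (last w s); rewrite ?inE ?ls.
have la := hole_link e_sym a0 hD.
have lb := hole_link e_sym b0 (hole_swap e_sym hD).
(* On the cycle through a and s, the connected set s' :|: b attaches to w, z and
   w'. *)
have hC' : hole e (w :: a ++ z :: rev s).
  apply: (hole_of_links e_sym la (link_rev e_sym lk)) => //.
  move=> u v ua'; rewrite mem_rev => vs; split.
    by apply: contraNneq (offD v vs) => <-; rewrite inE mem_cat ua' orbT.
  apply/negP => euv; have uC : u \in C by rewrite CE inE mem_cat ua' orbT.
  have us : has (e u) s by apply/hasP; exists v.
  have [uw|uz] := link_attachments hC lk off wC zC wz uC us.
    by rewrite -uw ua' in wa.
  by rewrite -uz ua' in za.
have [hb zb' lb' wb'] := link_ends lb.
have cX : connected_in e ([set v in s'] :|: [set v in b]).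
  apply: (connected_inU e_sym (x := last w' s') (y := z')); rewrite ?inE ?zl' ?orbT //.
    exact: connected_in_link lb.
  by rewrite e_sym zl' orbT.
apply: (no_three_attachments_set hC' cX (a := w) (b := z) (c := w')) => //.
- move=> v; rewrite !inE => /orP[vs'|vb].
    have := off' v vs'; rewrite CE !(inE, mem_cat, mem_rev).
    move=> /norP[/negbTE-> /norP[/negbTE-> /norP[/negbTE-> _]]] /=.
    exact: dis.
  rewrite !negb_or mem_cat inE mem_rev !negb_or.
  apply/and4P; split.
  - by apply: contraNneq wb => <-.
  - exact: ab.
  - by apply: contraNneq zb => <-.
  - by apply/negP => /offD; rewrite inE mem_cat inE vb !orbT.
- exact: mem_head.
- by rewrite inE mem_cat inE eqxx !orbT.
- by rewrite inE mem_cat w'a orbT.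
- by rewrite eq_sym.
- by rewrite eq_sym.
- by exists (last z b); rewrite // !inE lb' orbT.
- by exists (head z b); rewrite // !inE hb orbT.
- by have [] := w'z'X _ (subsetUl [set v in s'] [set v in b]).
Qed.

End Crossing.

(** * Minimal separators and cages *)

Section Separators.
Variables (T : finType) (e : rel T).
Hypotheses (e_sym : symmetric e).

Definition side (R : {set T}) (u : T) : {set T} :=
  [set a | connect (del_edges e R) u a].

Lemma del_edges_connect_sym R : connect_sym (del_edges e R).
Proof. by apply: sym_connect_sym => a b; rewrite /del_edges /= andbCA e_sym. Qed.

Lemma side_disjoint (R : {set T}) u a : u \notin R -> a \in side R u -> a \notin R.
Proof.
rewrite inE => uR /connectP[p]; elim: p u uR => [|b p IH] u uR /=.
  by move=> _ ->.
by move=> /andP[/and3P[_ bR _] pp]; apply: IH.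
Qed.

Lemma side_closed (R : {set T}) u a b :
  u \notin R -> a \in side R u -> e a b -> b \notin R -> b \in side R u.
Proof.
move=> uR aS ab bR; have aR := side_disjoint uR aS.
move: aS; rewrite !inE => ua; apply: connect_trans ua _.
by apply: connect1; rewrite /del_edges /= aR bR.
Qed.

Lemma side_connected (R : {set T}) u : u \notin R -> connected_in e (side R u).
Proof.
move=> uR.
have sym : connect_sym (restrict e (side R u)).
  by apply: sym_connect_sym => a b; rewrite /restrict /= andbCA e_sym.
have from_u a : a \in side R u -> connect (restrict e (side R u)) u a.
  rewrite inE => /connectP[p pp ->]; apply/connectP; exists p => //.
  have uS : u \in side R u by rewrite inE.
  suff gen x : x \in side R u -> path (del_edges e R) x p ->
      path (restrict e (side R u)) x p by apply: gen.
  elim: {pp} p x => //= b p IH x xS /andP[/[dup] xb /and3P[_ _ exb] pp].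
  have bS : b \in side R u.
    by move: xS; rewrite !inE => /connect_trans; apply; apply: connect1.
  by rewrite {1}/restrict /= xS bS exb; apply: IH.
move=> a b aS bS; apply: connect_trans (from_u b bS).
by rewrite sym; apply: from_u.
Qed.

Lemma separatorC u v : separator e u v =1 separator e v u.
Proof. by move=> R; rewrite /separator del_edges_connect_sym andbCA. Qed.

(** Were no vertex on the side of [u] adjacent to [r], putting [r] back would not enlarge that side,
    and [R :\ r] would still separate [u] from [v]. *)
Lemma separator_neighbour u v R r :
  minset (separator e u v) R -> r \in R -> exists2 a, a \in side R u & e r a.
Proof.
move=> /minsetP[/and3P[uR vR uv] minR] rR.
case: (boolP [exists a in side R u, e r a]) => [/exists_inP[a]|]; first by exists a.
move=> noA; case/negP: uv.
have : ~~ separator e u v (R :\ r).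
  apply/negP => /minR/(_ (subsetDl _ _)) E.
  by have := setD11 r R; rewrite E rR.
rewrite /separator !in_setD1 (negbTE uR) (negbTE vR) !andbF /= negbK.
have uS : u \in side R u by rewrite inE.
case/connectP => p pp ->.
suff gen x : x \in side R u -> path (del_edges e (R :\ r)) x p ->
    last x p \in side R u by have := gen u uS pp; rewrite inE.
elim: {pp} p x => //= b p IH x xS /andP[/and3P[_ bRr exb] pp].
apply: IH pp; have br : b != r.
  apply: contraNneq noA => br; apply/exists_inP; exists x => //.
  by rewrite e_sym -br.
by apply: side_closed uR xS exb _ => //; rewrite in_setD1 br in bRr.
Qed.

End Separators.

Lemma uniq_flatten_map (S T : eqType) (f : S -> seq T) (s : seq S) :
  uniq s -> {in s, forall x, uniq (f x)} ->
  {in s &, forall x y, x != y -> {in f x, forall v, v \notin f y}} ->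
  uniq (flatten (map f s)).
Proof.
elim: s => //= x s IH /andP[xs us] uf dis; rewrite cat_uniq uf ?mem_head //=.
apply/andP; split; last first.
  apply: IH => // [y ys|y z ys zs]; first by apply: uf; rewrite inE ys orbT.
  by apply: dis; rewrite inE ?ys ?zs orbT.
apply/hasPn => v /flatten_mapP[y ys vy]; apply/negP => vx.
have xy : x != y by apply: contraNneq xs => ->.
have y_s : y \in x :: s by rewrite inE ys orbT.
by have := dis x y (mem_head _ _) y_s xy v vx; rewrite vy.
Qed.

Section Cage.
Variables (T : finType) (e : rel T) (h : nat).
Hypotheses (e_sym : symmetric e) (e_irr : irreflexive e).
Hypotheses (h_ge3 : 2 < h) (G_SC : SC e (2 * h)).

(** The vertex [v] cuts both paths, not necessarily at the same position. The two parts before [v]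
    have fewer than [2 * h] edges together, and so do the two parts after it; hence both pairs agree
    by [short_path_uniq]. *)
Lemma cage_paths_disjoint w z s s' v :
  path e w (rcons s z) -> path e w (rcons s' z) ->
  uniq (w :: rcons s z) -> uniq (w :: rcons s' z) ->
  size s = h.-1 -> size s' = h.-1 -> v \in s -> v \in s' -> s = s'.
Proof.
move=> ps ps' us us' ss ss' /[swap].
move=> /splitPr vs'; case: vs' ps' us' ss' => a' b' ps' us' ss' vs.
case/splitPr: vs ps us ss => a b.
rewrite rcons_cat rcons_cons -cat_rcons -cat_cons size_cat /=.
move: ps' us' ss'; rewrite rcons_cat rcons_cons -cat_rcons -cat_cons size_cat /=.
rewrite !cat_path !last_rcons !cat_uniq.
rewrite !mem_cat !negb_or.
move=> /andP[pa' pb'] /and4P[/andP[wa' _] ua' /hasPn na' ub'] sz' /andP[pa pb].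
move=> /and4P[/andP[wa _] ua /hasPn na ub] sz.
rewrite -!cat_rcons; have -> : rcons a v = rcons a' v.
  apply: (short_path_uniq e_sym e_irr h_ge3 G_SC pa pa'); rewrite /= ?wa ?wa' //.
    by rewrite !last_rcons.
  by rewrite !size_rcons; lia.
suff : rcons b z = rcons b' z by move/rcons_inj => [->].
apply: (short_path_uniq e_sym e_irr h_ge3 G_SC pb pb').
- by rewrite /= ub andbT; apply/negP => /na; rewrite /= mem_rcons mem_head.
- by rewrite /= ub' andbT; apply/negP => /na'; rewrite /= mem_rcons mem_head.
- by rewrite !last_rcons.
- by rewrite !size_rcons; lia.
Qed.

(** Two opposite vertices cut the cycle into two paths with [h - 1] inner vertices. This settles
    separators with at most two vertices. *)
Lemma cage_of_cycle c :
  graph_cycle e c -> size c = 2 * h -> contains_cage e 2 (h + 1).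
Proof.
move=> /and3P[_ cc uc] sc.
have [w [p [z [q [E sp sq]]]]] : exists w p z q,
    [/\ c = w :: p ++ z :: q, size p = h.-1 & size q = h.-1].
  case: c {cc uc} sc => [|w t] /= st; first by lia.
  exists w, (take h.-1 t).
  case E : (drop h.-1 t) (size_drop h.-1 t) => [|z q] /= sq; first by lia.
  exists z, q; rewrite -E cat_take_drop size_takel; last by lia.
  by split=> //; lia.
exists w, z, [:: p; rev q].
move: cc uc; rewrite E /= rcons_cat /= -cat_rcons cat_path last_rcons.
move=> /andP[pp pq] up; split=> //.
- move=> s; rewrite !inE => /orP[] /eqP ->; rewrite ?size_rev ?sp ?sq.
    by split=> //; lia.
  split; first by lia.
  have -> : rcons (rev q) z = rev (belast z (rcons q w)).
    by rewrite belast_rcons rev_cons.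
  have -> : path e w = path e (last z (rcons q w)) by rewrite last_rcons.
  by rewrite rev_path; apply: sub_path pq => a b; rewrite e_sym.
- have P : perm_eq (w :: p ++ z :: q) (w :: z :: flatten [:: p; rev q]).
    apply/permP => P; rewrite /= cats0 !count_cat /= count_rev.
    by congr (_ + _); apply: addnCA.
  by move: (perm_uniq P) => /= <-.
Qed.

(** * The cage between two connected sets attached to all of R *)

Section Sides.
Variables A B R : {set T}.
Hypotheses (A_conn : connected_in e A) (B_conn : connected_in e B).
Hypotheses (A_R : {in A, forall a, a \notin R})
  (B_R : {in B, forall b, b \notin R}) (A_B : {in A, forall a, a \notin B}).
Hypothesis A_closed : forall a b, a \in A -> e a b -> b \notin R -> b \in A.
Hypothesis R_A : {in R, forall r, exists2 a, a \in A & e r a}.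
Hypothesis R_B : {in R, forall r, exists2 b, b \in B & e r b}.

Lemma path_meets_R w s z :
  w \in A -> z \in B -> path e w (rcons s z) -> exists2 r, r \in s & r \in R.
Proof.
elim: s w => [|x s IH] w wA zB /= /andP[ewx pp].
  have := A_closed wA ewx (B_R zB) => /A_B.
  by rewrite zB.
have [xR|xR] := boolP (x \in R); first by exists x; rewrite ?mem_head.
have [r rs rR] := IH x (A_closed wA ewx xR) zB pp.
by exists r; rewrite // inE rs orbT.
Qed.

(** Follow a path in [X] from a neighbour of [r] and stop at the first vertex [w] of [p]. The list
    [q] is empty when that neighbour is already on [p]. *)
Lemma path_to_subset (X : {set T}) (p : seq T) r :
  connected_in e X -> {subset p <= X} -> p != [::] ->
  (exists2 a, a \in X & e r a) ->
  exists q w, [/\ path e r (rcons q w), {subset q <= X}, w \in p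
    & {in q, forall v, v \notin p}].
Proof.
move=> cX pX p0 [a aX ra].
have [x xp] : exists x, x \in p.
  by case: (p) p0 => // x p' _; exists x; apply: mem_head.
have [l pl lx] := connectP (cX a x aX (pX x xp)).
have hl : has (mem p) (a :: l).
  by apply/hasP; exists x => //; rewrite lx mem_last.
have lX : {subset a :: l <= X}.
  move=> v; rewrite inE => /orP[/eqP->//|].
  elim: (l) (a) pl => //= b l' IH c /andP[/and3P[_ bX _] /IH lX].
  by rewrite inE => /orP[/eqP->|].
have rl : path e r (a :: l).
  by rewrite /= ra; apply: sub_path pl => u v /and3P[].
have [q [w [t [E wp qN]]]] : exists q w t,
    [/\ a :: l = q ++ w :: t, w \in p & ~~ has (mem p) q].
  by case: (split_find hl) => w q t *; exists q, w, t; rewrite cat_rcons.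
exists q, w; split=> //.
- by move: rl; rewrite E -cat_rcons cat_path => /andP[].
- by move=> v vq; apply: lX; rewrite E mem_cat vq.
- by move=> v vq; apply: contra qN => vp; apply/hasP; exists v.
Qed.

(** Paths from [r] through [A] to [p] and through [B] to [p'] form a connected set [X] off the
    cycle, and the ear is a link inside [X]. It leads from [A] to [B], so it meets [R], and [r] is
    the only vertex of [R] in [X]. *)
Lemma ear_through (p p' : seq T) r1 r2 r :
  {subset p <= A} -> {subset p' <= B} -> p != [::] -> p' != [::] ->
  r1 \in R -> r2 \in R -> r \in R -> r != r1 -> r != r2 ->
  exists w s z, [/\ link e w s z, w \in p, z \in p',
    {in s, forall v, v \notin r1 :: p ++ r2 :: p'}
    & r \in s /\ {in s, forall v, v \in R -> v = r}].
Proof.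
move=> pA p'B p0 p'0 r1R r2R rR rr1 rr2.
have [q [w [rw qA wp qp]]] := path_to_subset A_conn pA p0 (R_A rR).
have [q' [z [rz q'B zp' qp']]] := path_to_subset B_conn p'B p'0 (R_B rR).
pose X := [set v in r :: q] :|: [set v in r :: q'].
have inX v : v \in X -> [\/ v = r, v \in q | v \in q'].
  rewrite !inE -orbA => /or4P[/eqP|vq|/eqP|vq']; by constructor.
have wA := pA w wp; have zB := p'B z zp'.
have B_A b : b \in B -> b \notin A by apply: contraL => /A_B.
have offX v : v \in X -> v \notin r1 :: p ++ r2 :: p'.
  move=> /inX vX; rewrite inE mem_cat inE !negb_or; case: vX => [->|vq|vq'].
  - rewrite rr1 rr2 /=; apply/andP; split.
      by apply: contraL rR => /pA/A_R.
    by apply: contraL rR => /p'B/B_R.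
  - have vA := qA v vq; rewrite qp //=; apply/and3P; split.
    + by apply: contraNneq (A_R vA) => ->.
    + by apply: contraNneq (A_R vA) => ->.
    + by apply: contra (A_B vA) => /p'B.
  - have vB := q'B v vq'; rewrite qp' //= andbT; apply/and3P; split.
    + by apply: contraNneq (B_R vB) => ->.
    + by apply: contra (B_A _ vB) => /pA.
    + by apply: contraNneq (B_R vB) => ->.
have cX : connected_in e X.
  apply: (connected_inU e_sym (x := r) (y := r)); rewrite ?inE ?eqxx //.
    apply: connected_in_path => //.
    by move: rw; rewrite rcons_path => /andP[].
  apply: connected_in_path => //.
  by move: rz; rewrite rcons_path => /andP[].
have wX : w \notin X.
  by apply/negP => /offX; rewrite inE mem_cat wp orbT.
have zX : z \notin X.
  by apply/negP => /offX; rewrite inE mem_cat inE zp' !orbT.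
have [s sX lk] : exists2 s, {subset s <= X} & link e w s z.
  apply: (link_exists cX wX zX (u := last r q) (v := last r q')).
  - by apply/setUP; left; rewrite inE mem_last.
  - by move: rw; rewrite rcons_path e_sym => /andP[].
  - by apply/setUP; right; rewrite inE mem_last.
  - by move: rz; rewrite rcons_path e_sym => /andP[].
have sR v : v \in s -> v \in R -> v = r.
  move=> /sX/inX[//|/qA/A_R|/q'B/B_R] vN vR; by rewrite vR in vN.
exists w, s, z; split=> //; first by move=> v /sX; apply: offX.
split=> //.
have [v vs vR] := path_meets_R wA zB (link_path e_sym lk).
by rewrite -(sR v).
Qed.

Lemma nonadjacent_pair : 2 < #|R| ->
  exists r1 r2, [/\ r1 \in R, r2 \in R, r1 != r2 & ~~ e r1 r2].
Proof.
move=> /card_gt2P[x [y [z [[xR yR zR] [xy yz zx]]]]].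
have [exy|exy] := boolP (e x y); last by exists x, y.
have [eyz|eyz] := boolP (e y z); last by exists y, z.
exists z, x; split=> //.
by apply/negP => ezx; apply: (no_triangle e_sym e_irr h_ge3 G_SC exy eyz).
Qed.

Lemma cage_of_sides : 2 < #|R| -> contains_cage e #|R| (h + 1).
Proof.
move=> R3; have [r1 [r2 [r1R r2R r12 er12]]] := nonadjacent_pair R3.
have notR (X : {set T}) : {in X, forall x, x \notin R} ->
    forall r, r \in R -> r \notin X.
  by move=> XR r rR; apply: contraL rR => /XR.
have [a1 a1A ra1] := R_A r1R; have [a2 a2A ra2] := R_A r2R.
have [b1 b1B rb1] := R_B r1R; have [b2 b2B rb2] := R_B r2R.
have [p pA lp] := link_exists A_conn (notR A A_R _ r1R) (notR A A_R _ r2R)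
  a1A ra1 a2A ra2.
have [p' p'B lp'] := link_exists B_conn (notR B B_R _ r2R) (notR B B_R _ r1R)
  b2B rb2 b1B rb1.
have A_B_edge a b : a \in A -> b \in B -> a != b /\ ~~ e a b.
  move=> aA bB; split; first by apply: contraTneq aA => ->; apply: contraL bB => /A_B.
  by apply: contraL bB => /(A_closed aA) bA; apply/negP => bB; have := A_B (bA (B_R bB)); rewrite bB.
have hC : hole e (r1 :: p ++ r2 :: p').
  apply: (hole_of_links e_sym lp lp' r12 er12) => a b /pA aA /p'B bB.
  exact: A_B_edge.
set C := r1 :: p ++ r2 :: p' in hC.
have pC : {subset p <= C} by move=> v vp; rewrite inE mem_cat vp orbT.
have p'C : {subset p' <= C}.
  by move=> v vp; rewrite inE mem_cat inE vp !orbT.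
have p0 : p != [::] by case: lp.
have p'0 : p' != [::] by case: lp'.
have ear r := @ear_through p p' r1 r2 r pA p'B p0 p'0 r1R r2R.
(* The ear of one further vertex [r3] fixes [w] and [z], and forces both arcs of [C] between them to
   have [h - 1] inner vertices. *)
have [r3 r3R /andP[r31 r32]] : exists2 r, r \in R & (r != r1) && (r != r2).
  have /subsetPn[r rR] : ~~ (R \subset [set r1; r2]).
    apply: contraL R3 => /subset_leq_card sub.
    by rewrite -leqNgt (leq_trans sub) // cards2; case: (_ != _).
  by rewrite !inE negb_or; exists r.
have [w [s3 [z [l3 wp zp' off3 _]]]] := ear r3 r3R r31 r32.
have [wA zB] := (pA w wp, p'B z zp').
have [wz ewz] := A_B_edge w z wA zB.
have [a [b [hD CD]]] := hole_split e_sym hC (pC w wp) (p'C z zp') wz.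
have [a0 b0] : a != [::] /\ b != [::].
  by apply/andP; rewrite -negb_or -(hole_adj hD).
have ear_len s : link e w s z -> {in s, forall v, v \notin C} ->
    [/\ size a = h.-1, size b = h.-1 & size s = h.-1].
  move=> lk off; have offD : {in s, forall v, v \notin w :: a ++ z :: b}.
    by move=> v /off; rewrite CD.
  by case: (ear_size_clean e_sym e_irr h_ge3 G_SC hD lk offD) => [E|E|//];
     rewrite E in a0 b0.
have [sa sb _] := ear_len s3 l3 off3.
(* The cage will consist of one spoke for each [r]; meeting [R] only in [r] makes the spokes of
   different vertices different. *)
pose spoke r s := [/\ path e w (rcons s z), uniq (w :: rcons s z),
  size s = h.-1, r \in s & {in s, forall v, v \in R -> v = r}].
have link_spoke r s : link e w s z -> size s = h.-1 -> r \in s ->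
    {in s, forall v, v \in R -> v = r} -> spoke r s.
  move=> lk ss rs sR; split=> //; first exact: link_path lk.
  case: lk => _ ips [ws zs] _.
  by rewrite /= mem_rcons inE negb_or wz ws rcons_uniq zs (induced_path_uniq ips).
have la := hole_link e_sym a0 hD.
have lb := link_rev e_sym (hole_link e_sym b0 (hole_swap e_sym hD)).
have CR v : v \in C -> v \in R -> v = r1 \/ v = r2.
  rewrite inE mem_cat inE => /or4P[/eqP->|/pA/A_R/negP//|/eqP->|/p'B/B_R/negP//] _.
    by left.
  by right.
have [subaC subbC] : {subset a <= C} /\ {subset rev b <= C}.
  split=> v; rewrite ?mem_rev => vab; rewrite CD inE mem_cat inE vab ?orbT //.
have ab : {in a, forall v, v \notin rev b}.
  have := hole_uniq e_sym hD; rewrite /= cat_uniq /= negb_or.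
  move=> /and5P[_ _ /andP[_ /hasPn dis] _ _] v va.
  by rewrite mem_rev; apply/negP => /dis; rewrite /= va.
(* On [C] only [r1] and [r2] belong to [R], and each arc from [w] to [z] must cross [R], so each arc
   contains exactly one of them. *)
have arc_spoke (c d : seq T) r : link e w c z -> link e w d z ->
    size c = h.-1 -> {subset c <= C} -> {subset d <= C} ->
    {in c, forall v, v \notin d} -> r \in R -> r \in c -> spoke r c.
  move=> lc ld sc cC dC cd rR rc; apply: link_spoke => // v vc vR.
  have [x xd xR] := path_meets_R wA zB (link_path e_sym ld).
  have xr : x != r by apply: contraTneq xd => ->; apply: cd.
  have xv : x != v by apply: contraTneq xd => ->; apply: cd.
  have [xE rE vE] := And3 (CR x (dC x xd) xR) (CR r (cC r rc) rR) (CR v (cC v vc) vR).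
  by move: xr xv; case: vE => ->; case: rE => -> //; case: xE => ->; rewrite eqxx.
(* The condition [r \in R] sits under the existential so that [fin_all_exists] yields a choice
   function on all of [T]. *)
have spokes r : exists s, r \in R -> spoke r s.
  have [rR|rR] := boolP (r \in R); last by exists [::].
  have [rC|rC] := boolP (r \in C).
    have : r \in a \/ r \in rev b.
      have := rC; rewrite CD inE mem_cat inE mem_rev.
      case/or4P=> [/eqP rw||/eqP rz|]; [|by left| |by right].
        by move: rR; rewrite rw (negbTE (A_R wA)).
      by move: rR; rewrite rz (negbTE (B_R zB)).
    case=> rab; [exists a | exists (rev b)] => _.
      exact: (arc_spoke a (rev b)).
    apply: (arc_spoke (rev b) a); rewrite ?size_rev //.
    by move=> v; apply: contraL => /ab.
  have [rr1 rr2] : r != r1 /\ r != r2.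
    split; apply: contraNneq rC => ->; first exact: mem_head.
    by rewrite inE mem_cat inE eqxx !orbT.
  have [w' [s [z' [lk w'p z'p' off [rs sR]]]]] := ear r rR rr1 rr2.
  have [wA' zB'] := (pA w' w'p, p'B z' z'p').
  have [wz' ewz'] := A_B_edge w' z' wA' zB'.
  (* The ends of this ear are those of the ear of [r3]; [w' = z] is excluded since [w'] is in [A]
     and [z] in [B]. *)
  have ww : w' = w.
    have [//|wE] := ear_off_ends e_sym e_irr h_ge3 G_SC hC l3 lk off3 off
      (pC w wp) (p'C z zp') (pC w' w'p) (p'C z' z'p') wz ewz wz' ewz'.
    by have := A_B wA'; rewrite wE zB.
  have offr : {in rev s, forall v, v \notin C} by move=> v; rewrite mem_rev => /off.
  have zz : z' = z.
    rewrite eq_sym in wz'; rewrite e_sym in ewz'.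
    have [zE|//] := ear_off_ends e_sym e_irr h_ge3 G_SC hC l3 (link_rev e_sym lk)
      off3 offr (pC w wp) (p'C z zp') (p'C z' z'p') (pC w' w'p) wz ewz wz' ewz'.
    by have := A_B wA; rewrite -zE zB'.
  subst w' z'; exists s => _; apply: link_spoke => //.
  by have [] := ear_len s lk off.
have [f fP] := fin_all_exists spokes.
exists w, z, [seq f r | r <- enum R]; split.
- by rewrite size_map -cardE.
- move=> q /mapP[r]; rewrite mem_enum => /fP[pr _ sr _ _] ->.
  by split=> //; rewrite sr addn1 subSS subn1.
- rewrite /= inE negb_or wz /=.
  have ends v : v \in flatten [seq f r | r <- enum R] -> v != w /\ v != z.
    move=> /flatten_mapP[r]; rewrite mem_enum => /fP[_ + _ _ _].
    rewrite /= mem_rcons inE negb_or rcons_uniq => /andP[/andP[_ wf] /andP[zf _]] vf.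
    by split; [apply: contraNneq wf | apply: contraNneq zf] => <-.
  apply/and3P; split.
  + by apply/negP => /ends[]; rewrite eqxx.
  + by apply/negP => /ends[_]; rewrite eqxx.
  apply: uniq_flatten_map; first exact: enum_uniq.
    move=> r; rewrite mem_enum => /fP[_ + _ _ _].
    by rewrite /= rcons_uniq => /and3P[].
  (* A common vertex would make the two spokes equal, and their only vertex in [R] would be both [x]
     and [y]. *)
  move=> x y; rewrite !mem_enum => xR yR xy v vx; apply: contra xy => vy.
  have [px ux sx xx _] := fP x xR; have [py uy sy _ yR'] := fP y yR.
  have E := cage_paths_disjoint px py ux uy sx sy vx vy.
  by apply/eqP; apply: yR' => //; rewrite -E.
Qed.

End Sides.

(** The sides of [u] and [v] serve as [A] and [B]; exchanging [u] and [v] gives the neighbours in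
    [B]. *)
Lemma minimal_separator_cage R :
  minimal_vertex_separator e R -> 2 < #|R| -> contains_cage e #|R| (h + 1).
Proof.
move=> [u [v [_ _ minR]]].
have minR' : minset (separator e v u) R.
  by rewrite -(minset_eq _ (separatorC e_sym u v)).
have /minsetP[/and3P[uR vR uv] _] := minR.
apply: (cage_of_sides (A := side e R u) (B := side e R v)).
- exact: side_connected.
- exact: side_connected.
- by move=> a; apply: side_disjoint.
- by move=> a; apply: side_disjoint.
- move=> a; rewrite !inE => ua; apply: contra uv => va.
  by apply: connect_trans ua _; rewrite del_edges_connect_sym.
- by move=> a b; apply: side_closed.
- by move=> r; apply: separator_neighbour minR.
- by move=> r; apply: separator_neighbour minR'.
Qed.

End Cage.

Theorem theorem2 (T : finType) (e : rel T) (m k s : nat)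
    (e_sym : symmetric e) (e_irr : irreflexive e)
    (m_ge1 : 1 <= m) (k_def : k = 2 * m + 4)
    (G_conn : connected_graph e) (G_SC : SC e k)
    (G_cycles : exists Si Sj : seq T,
        [/\ induced_cycle e Si, induced_cycle e Sj
          & #|cycle_edges Si :&: cycle_edges Sj| = k %/ 2])
    (s_max : max_cage_size e (k %/ 2 + 1) s) :
  forall R : {set T}, minimal_vertex_separator e R -> #|R| <= s.
Proof.
move=> R sepR; pose h := m + 2.
have kE : k = 2 * h by rewrite k_def /h; lia.
have khE : k %/ 2 = h by rewrite kE mulKn.
have h_ge3 : 2 < h by rewrite /h; lia.
rewrite khE in s_max; case: s_max => _ max_s; rewrite kE in G_SC.
have [R2|R3] := leqP #|R| 2; last first.
  exact: max_s (minimal_separator_cage e_sym e_irr h_ge3 G_SC sepR R3).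
(* For at most two vertices, a given induced cycle suffices: it rules out the acyclic case of [SC],
   has length [2 * h], and yields a cage with two paths. *)
have [c [_ [ic _ _]]] := G_cycles; have [gc _] := ic.
have sc : size c = 2 * h by case: G_SC => [[]|Gk]; [exists c | apply: Gk].
exact: leq_trans R2 (max_s _ (cage_of_cycle e_sym h_ge3 gc sc)).
Qed.
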